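(* Let $\rho(n)$ denote the Abelian complexity of the Tribonacci word $\mathbf{t}$. Then $\rho(n)\in\{3,4,5,6,7\}$ for every positive integer $n$, and each of the five values $3,4,5,6,7$ is attained, i.e. for each $m\in\{3,4,5,6,7\}$ there exists $n\ge1$ with $\rho(n)=m$.
   Context: Let $\tau$ be the morphism on $\{0,1,2\}^*$ given by $0\mapsto 01$, $1\mapsto 02$, $2\mapsto 0$, and let $\mathbf{t}=\lim_{n\to\infty}\tau^n(0)$ be its fixed point (the Tribonacci word). A factor of an infinite word is a finite block of consecutive letters. Two finite words $u,v$ are Abelian equivalent if $|u|_a=|v|_a$ for every letter $a$ (where $|u|_a$ is the number of occurrences of $a$ in $u$). The Abelian complexity $\rho(n)$ is the number of Abelian equivalence classes among the factors of $\mathbf{t}$ of length $n$, equivalently the number of distinct Parikh vectors $(|u|_0,|u|_1,|u|_2)$ of factors $u$ of $\mathbf{t}$ of length $n$. *)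

(* Defs.v *)
From HB Require Import structures.
From mathcomp Require Import all_boot.
From mathcomp Require Import boolp.

Set Implicit Arguments.
Unset Strict Implicit.
Unset Printing Implicit Defensive.

Section InfiniteWords.
Variable A : finType.

Definition is_factor (w : nat -> A) (u : seq A) : Prop :=
  exists i : nat, u = mkseq (fun k => w (i + k)) (size u).

Definition factors (w : nat -> A) (n : nat) : {set n.-tuple A} :=
  [set u : n.-tuple A | `[< is_factor w u >]].

Definition abelian_equiv (u v : seq A) : bool :=
  [forall a : A, count_mem a u == count_mem a v].

Definition abelian_complexity (w : nat -> A) (n : nat) : nat :=
  #|equivalence_partition (fun u v : n.-tuple A => abelian_equiv u v)
      (factors w n)|.

(* [equivalence_partition] is only meaningful for an equivalence relation. *)
Lemma abelian_equiv_equivalence (n : nat) :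
  equivalence_rel (fun u v : n.-tuple A => abelian_equiv u v).
Proof.
move=> u v x; split; first by apply/forallP.
move=> /forallP uv; apply/forallP/forallP => h a.
  by rewrite -(eqP (uv a)) h.
by rewrite (eqP (uv a)) h.
Qed.

Definition is_word_limit (s : nat -> seq A) (w : nat -> A) : Prop :=
  forall k, exists N, forall n, N <= n -> prefix (mkseq w k) (s n).

End InfiniteWords.

Notation letter0 := (@Ordinal 3 0 isT).
Notation letter1 := (@Ordinal 3 1 isT).
Notation letter2 := (@Ordinal 3 2 isT).

Definition tau_letter (a : 'I_3) : seq 'I_3 :=
  match val a with
  | 0 => [:: letter0; letter1]
  | 1 => [:: letter0; letter2]
  | _ => [:: letter0]
  end.

Definition tau (u : seq 'I_3) : seq 'I_3 := flatten (map tau_letter u).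

(* tau^i(0) has length > i and is a prefix of tau^(i+1)(0), so its i-th letter
   is the i-th letter of the limit; see [tribonacci_limit]. *)
Definition tribonacci (i : nat) : 'I_3 :=
  nth letter0 (iter i tau [:: letter0]) i.

Lemma tau_cat u v : tau (u ++ v) = tau u ++ tau v.
Proof. by rewrite /tau map_cat flatten_cat. Qed.

Lemma tau_iter_prefix m n : m <= n ->
  prefix (iter m tau [:: letter0]) (iter n tau [:: letter0]).
Proof.
have step k : prefix (iter k tau [:: letter0]) (iter k.+1 tau [:: letter0]).
  elim: k => [|k IH] //; rewrite iterS [X in prefix _ X]iterS.
  by case/prefixP: IH => s ->; rewrite tau_cat prefix_prefix.
move=> /subnK <-; elim: (n - m) => [|d IH]; first exact: prefix_refl.
exact: prefix_trans IH (step _).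
Qed.

Lemma leq_size_tau u : size u <= size (tau u).
Proof.
elim: u => // a u IH; rewrite -cat1s tau_cat !size_cat leq_add //.
by case: a => [[|[|[|]]]].
Qed.

Lemma tau_iter_head n : exists u, iter n tau [:: letter0] = letter0 :: u.
Proof. by have /prefixP[u ->] := tau_iter_prefix (leq0n n); exists u. Qed.

Lemma ltn_size_tau_iter n : n < size (iter n tau [:: letter0]).
Proof.
elim: n => // n IH; rewrite iterS; have [u E] := tau_iter_head n.
rewrite E in IH *; rewrite -cat1s tau_cat size_cat /= -addn2 addnC.
by rewrite leq_add2l; apply: leq_trans (leq_size_tau u).
Qed.

Lemma tribonacci_limit :
  is_word_limit (fun n => iter n tau [:: letter0]) tribonacci.
Proof.
move=> k; exists k => n le_kn.
suff -> : mkseq tribonacci k = take k (iter n tau [:: letter0]).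
  exact: prefix_take.
have le_k : k <= size (iter n tau [:: letter0]).
  exact: leq_trans le_kn (ltnW (ltn_size_tau_iter n)).
apply: (@eq_from_nth _ letter0); first by rewrite size_mkseq size_takel.
move=> i; rewrite size_mkseq => lt_ik; rewrite nth_mkseq // nth_take //.
have /prefixP[s ->] := tau_iter_prefix (leq_trans (ltnW lt_ik) le_kn).
by rewrite nth_cat ltn_size_tau_iter.
Qed.

(* Main.v *)
From Stdlib Require Import ZArith.
Require Import Defs.
From HB Require Import structures.
From mathcomp Require Import all_boot boolp ssrZ zify.

Set Implicit Arguments.
Unset Strict Implicit.
Unset Printing Implicit Defensive.

(** Let [P k] be the Parikh vector of the prefix of length [k] of the
Tribonacci word [t].  The factor of length [n] at position [i] has Parikh vector
[P j - P i] with [j = i + n], so the Abelian complexity at [n] is the number of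
vectors [P j - P i - P n] with [j = i + n].  Attach to a triple of positions
[(i, n, j)] the letters [t i], [t n], [t j] and the defect [P j - P i - P n],
whose coordinates add up to [j - i - n].  Every position lies in the image under
[tau] of a unique letter of [t]; passing to the positions of these letters gives
the parent of the triple, and the letters and defect of a triple are a function
of those of its parent and of the offsets in the three blocks.

Among the triples with [-1 <= j - i - n <= 3], only 474 combinations of letters
and defect occur.  The induction behind this needs the parent of such a triple
to satisfy the same bounds: if [j' - i' - n' > 3] for the parent, then already
the triple [(i', n', i' + n' + 3)] has its children too far to the right, and
symmetrically at the other end.  Hence the set of combinations realised for a
given [n] depends only on the set realised for the parent of [n] and on the
offset of [n] in its block.  This is a finite automaton reading the
desubstitution of [n]; it has 188 states for [n > 0], and the claim is checked
state by state. *)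

(** * Triples, their offspring and the automaton as finite computations *)

Fixpoint explore (T : eqType) (f : T -> seq T) (fuel : nat) (seen work : seq T) :
    seq T :=
  if fuel is k.+1 then
    let new := [seq x <- undup (flatten (map f work)) | x \notin seen] in
    explore f k (new ++ seen) new
  else seen.

Notation vec := (Z * Z * Z)%type.
Definition vadd (u v : vec) : vec :=
  let: (a, b, c) := u in let: (x, y, z) := v in (a + x, b + y, c + z)%Z.
Definition vsub (u v : vec) : vec :=
  let: (a, b, c) := u in let: (x, y, z) := v in (a - x, b - y, c - z)%Z.
Definition vlen (u : vec) : Z := let: (a, b, c) := u in (a + b + c)%Z.
(** The incidence matrix of [tau] acting on Parikh vectors. *)
Definition vtau (u : vec) : vec := let: (a, b, c) := u in (a + b + c, a, b)%Z.

(* The letters of [tau_letter a], each with the Parikh vector of the part of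
   [tau_letter a] before it. *)
Definition desc (a : nat) : seq (nat * vec) :=
  match a with
  | 0 => [:: (0, (0, 0, 0)%Z); (1, (1, 0, 0)%Z)]
  | 1 => [:: (0, (0, 0, 0)%Z); (2, (1, 0, 0)%Z)]
  | _ => [:: (0, (0, 0, 0)%Z)]
  end.

Record triple := Triple {
  start_letter : nat; len_letter : nat; end_letter : nat; defect : vec }.

(* The generic equality on nested pairs would make the kernel computations below
   several times slower. *)
Definition triple_eqb (x y : triple) : bool :=
  let: Triple a b c (u, v, w) := x in let: Triple a' b' c' (u', v', w') := y in
  [&& Z.eqb u u', Z.eqb v v', Z.eqb w w', eqn a a', eqn b b' & eqn c c'].

Lemma triple_eqP : Equality.axiom triple_eqb.
Proof.
move=> [a b c [[u v] w]] [a' b' c' [[u' v'] w']] /=.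
apply: (iffP and5P) => [|[-> -> -> -> -> ->]].
  case=> /Z.eqb_eq-> /Z.eqb_eq-> /Z.eqb_eq-> /eqnP->.
  by case/andP=> /eqnP-> /eqnP->.
by rewrite !Z.eqb_refl !eqnE !eqxx.
Qed.

HB.instance Definition _ := hasDecEq.Build triple triple_eqP.

Definition offspring_at (e : nat * vec) (x : triple) : seq triple :=
  let: Triple a _ c v := x in
  [seq Triple f.1 e.1 g.1 (vsub (vsub (vadd (vtau v) g.2) f.2) e.2)
  | f <- desc a, g <- desc c].

Definition offspring (x : triple) : seq triple :=
  flatten [seq offspring_at e x | e <- desc (len_letter x)].

Definition in_window (x : triple) : bool :=
  ((-1 <=? vlen (defect x)) && (vlen (defect x) <=? 3))%Z.

(* The triples of positions [(0, 0, j)] with [j <= 3]. *)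
Definition base : seq triple :=
  [:: Triple 0 0 0 (0, 0, 0)%Z; Triple 0 0 1 (1, 0, 0)%Z;
      Triple 0 0 0 (1, 1, 0)%Z; Triple 0 0 2 (2, 1, 0)%Z].

Definition state := (nat * seq triple)%type.

(* [K] collects the triples that are tracked; the triples in [S] have their
   middle position at the parent of the position described by [e]. *)
Definition step (K : seq triple) (e : nat * vec) (S : seq triple) : seq triple :=
  let S' := flatten [seq offspring_at e x | x <- S] in
  [seq y <- K | (len_letter y == e.1) && (y \in S')].

Definition next_states (K : seq triple) (s : state) : seq state :=
  [seq (e.1, step K e s.2) | e <- desc s.1].

(** Position 0 is its own parent, so the set realised at [n = 0] is a least fixed point, approached
    by iteration from [base]. *)
Definition grow (K S : seq triple) : seq triple :=
  let S' := S ++ step K (0, (0, 0, 0)%Z) S in [seq y <- K | y \in S'].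

Definition zero_set (K : seq triple) (k : nat) : seq triple :=
  iter k (grow K) [seq y <- K | y \in base].

Definition state1 (K : seq triple) (k : nat) : state :=
  (1, step K (1, (1, 0, 0)%Z) (zero_set K k)).

Definition states (K : seq triple) (k fuel : nat) : seq state :=
  explore (next_states K) fuel [:: state1 K k] [:: state1 K k].

(** Defect sum 0 means [j = i + n]: these triples come from the factors of length [n]. *)
Definition rho (s : state) : nat :=
  size (undup [seq defect x | x <- s.2 & (vlen (defect x) =? 0)%Z]).

(* The last clause says that the children of a triple at either end of the
   window are so far out that moving [j] further out cannot lead back into the
   window: if the coordinates of [v] add up to [s], those of [vtau v] add up to
   [2 * s - z], where [z] is the last one. *)
Definition window_ok (W K : seq triple) : bool :=
  [&& all (mem W) base, all in_window K &
    all (fun x =>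
      let ys := offspring x in
      [&& all (fun y => in_window y ==> (y \in W)) ys,
          (vlen (defect x) =? 0)%Z ==> (x \in K),
          has (mem K) ys ==> (x \in K)
        & let: Triple a b c (_, _, z) := x in
          ((vlen (defect x) =? 3) ==>
             (Z.of_nat (size (desc a) + size (desc b)) + z <?
                5 + Z.of_nat (size (desc c))))%Z &&
          ((vlen (defect x) =? -1) ==> (-1 <=? z))%Z]) W].

Definition automaton_ok (K : seq triple) (k fuel : nat) : bool :=
  let Z := zero_set K k in let L := states K k fuel in
  [&& all (fun y => (y \in K) ==> (y \in Z)) base,
      all (mem Z) (step K (0, (0, 0, 0)%Z) Z),
      state1 K k \in L, all (fun s => all (mem L) (next_states K s)) L,
      all (fun s => rho s \in [:: 3; 4; 5; 6; 7]) L
    & all (fun m => has (fun s => rho s == m) L) [:: 3; 4; 5; 6; 7]].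

(** * Soundness of the searches and consequences of the window check *)

(** This gives soundness only; that the fuel suffices is checked on the result, by [window_ok] and
    [automaton_ok]. *)
Lemma explore_ind (T : eqType) (f : T -> seq T) (P : T -> Prop) fuel seen work :
    (forall x y, P x -> y \in f x -> P y) ->
    (forall x, x \in seen -> P x) -> (forall x, x \in work -> P x) ->
  forall x, x \in explore f fuel seen work -> P x.
Proof.
move=> Pf; elim: fuel seen work => //= k IH seen work Pseen Pwork.
have Pnew x :
    x \in [seq x <- undup (flatten (map f work)) | x \notin seen] -> P x.
  rewrite mem_filter mem_undup => /andP[_ /flatten_mapP[y /Pwork]].
  exact: Pf.
by apply: IH => // x; rewrite mem_cat => /orP[]; [apply: Pnew | apply: Pseen].
Qed.

Lemma mem_step K e S y :
  y \in step K e S <-> [/\ y \in K, len_letter y = e.1 &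
                       exists2 x, x \in S & y \in offspring_at e x].
Proof.
rewrite mem_filter; split=> [/andP[/andP[/eqP ? /flatten_mapP]]|[-> -> yS]].
  by split.
by rewrite eqxx andbT; apply/flatten_mapP.
Qed.

Lemma zero_set_ind K k (P : triple -> Prop) :
    (forall x, x \in base -> P x) ->
    (forall x y, P x -> y \in offspring_at (0, (0, 0, 0)%Z) x -> P y) ->
  forall x, x \in zero_set K k -> x \in K /\ P x.
Proof.
move=> P0 Pstep; rewrite /zero_set.
elim: k => [|k IH] x; rewrite ?iterS mem_filter => /andP[].
  by move=> /P0.
rewrite mem_cat => /orP[/IH[] //|/mem_step[? _ [y /IH[_ Py] xy]] _].
by split=> //; apply: Pstep xy.
Qed.

Section Window.

Variables W K : seq triple.
Hypothesis WK_ok : window_ok W K.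

Lemma base_window x : x \in base -> x \in W.
Proof. by case/and3P: WK_ok => /allP h _ _ /h. Qed.

Lemma window_closed x y :
  x \in W -> y \in offspring x -> in_window y -> y \in W.
Proof.
case/and3P: WK_ok => _ _ /allP h /h /and4P[/allP hx _ _ _] /hx.
by move/implyP.
Qed.

Lemma window_core x : x \in W -> vlen (defect x) = 0%Z -> x \in K.
Proof.
by case/and3P: WK_ok => _ _ /allP h /h /and4P[_ /implyP hx _ _] E; rewrite hx ?E.
Qed.

Lemma core_closed x y :
  x \in W -> y \in offspring x -> y \in K -> x \in K.
Proof.
case/and3P: WK_ok => _ _ /allP h /h /and4P[_ _ /implyP hx _] xy yK.
by apply: hx; apply/hasP; exists y.
Qed.

Lemma window_top a b c u v z : Triple a b c (u, v, z) \in W ->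
  (u + v + z = 3)%Z ->
  (Z.of_nat (size (desc a) + size (desc b)) + z <
     5 + Z.of_nat (size (desc c)))%Z.
Proof.
case/and3P: WK_ok => _ _ /allP h /h /and4P[_ _ _ /andP[/implyP + _]] E.
by rewrite [vlen _]E => /(_ isT); lia.
Qed.

Lemma window_bottom a b c u v z : Triple a b c (u, v, z) \in W ->
  (u + v + z = -1)%Z -> (-1 <= z)%Z.
Proof.
case/and3P: WK_ok => _ _ /allP h /h /and4P[_ _ _ /andP[_ /implyP +]] E.
by rewrite [vlen _]E => /(_ isT); lia.
Qed.

Lemma core_in_window x : x \in K -> in_window x.
Proof. by case/and3P: WK_ok => _ /allP h _ /h. Qed.

End Window.

(** * Parikh vectors of prefixes and desubstitution of positions *)

Definition parikh (u : seq 'I_3) : vec :=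
  (Z.of_nat (count_mem letter0 u), Z.of_nat (count_mem letter1 u),
   Z.of_nat (count_mem letter2 u)).

Definition word_vec (n : nat) : vec := parikh (mkseq tribonacci n).

Definition triple_at (i n j : nat) : triple :=
  Triple (tribonacci i) (tribonacci n) (tribonacci j)
         (vsub (vsub (word_vec j) (word_vec i)) (word_vec n)).

Definition child (k : nat) (e : nat * vec) (n : nat) : Prop :=
  [/\ e \in desc (tribonacci k), tribonacci n = e.1 :> nat &
      word_vec n = vadd (vtau (word_vec k)) e.2].

Ltac vec_lia :=
  repeat match goal with v : vec |- _ => case: v => [[? ?] ?] end;
  rewrite /vsub /vadd /vtau /vlen; repeat congr pair; lia.

Lemma parikh_cat u v : parikh (u ++ v) = vadd (parikh u) (parikh v).
Proof. by rewrite /parikh !count_cat /vadd; congr (_, _, _); lia. Qed.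

Lemma vlen_parikh u : vlen (parikh u) = Z.of_nat (size u).
Proof.
have -> : size u =
    count_mem letter0 u + count_mem letter1 u + count_mem letter2 u.
  by elim: u => // -[[|[|[|]]] ?] //= u ->; lia.
by rewrite /parikh /vlen; lia.
Qed.

Lemma parikh_tau u : parikh (tau u) = vtau (parikh u).
Proof.
elim: u => // a u IH.
rewrite -cat1s tau_cat (parikh_cat (tau _)) (parikh_cat [:: a]) IH.
have -> : parikh (tau [:: a]) = vtau (parikh [:: a]).
  by case: a => [[|[|[|]]] ?].
by move: (parikh _) (parikh _) => v w; vec_lia.
Qed.

Lemma vlen_word_vec n : vlen (word_vec n) = Z.of_nat n.
Proof. by rewrite vlen_parikh size_mkseq. Qed.

Definition tau_pos (k : nat) : nat := size (tau (mkseq tribonacci k)).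

Lemma tau_pos_vec k : vlen (vtau (word_vec k)) = Z.of_nat (tau_pos k).
Proof. by rewrite -parikh_tau vlen_parikh. Qed.

(** Both sides are prefixes, of equal length, of one high iterate of [tau] on the letter 0. *)
Lemma tau_tribonacci k : tau (mkseq tribonacci k) = mkseq tribonacci (tau_pos k).
Proof.
have [N hN] := tribonacci_limit k; have [N' hN'] := tribonacci_limit (tau_pos k).
have /prefixP[s E] := hN (maxn N N') (leq_maxl _ _).
have := hN' (maxn N N').+1 (leq_trans (leq_maxr _ _) (leqnSn _)).
by rewrite iterS E tau_cat prefixE size_mkseq take_size_cat // => /eqP.
Qed.

Lemma size_desc (a : 'I_3) : size (tau_letter a) = size (desc a).
Proof. by case: a => [[|[|[|]]] ?]. Qed.

Lemma tau_mkseqS k :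
  tau (mkseq tribonacci k.+1) =
  tau (mkseq tribonacci k) ++ tau_letter (tribonacci k).
Proof. by rewrite mkseqS -cats1 tau_cat {2}/tau /= cats0. Qed.

Lemma tau_posS k : tau_pos k.+1 = tau_pos k + size (desc (tribonacci k)).
Proof. by rewrite /tau_pos tau_mkseqS size_cat size_desc. Qed.

Lemma tau_pos_lt k l :
  k < l -> tau_pos k + size (desc (tribonacci k)) <= tau_pos l.
Proof.
rewrite -tau_posS => /subnK <-; elim: (l - _) => //= d IH.
by rewrite addSn [in leqRHS]tau_posS; apply: leq_trans IH (leq_addr _ _).
Qed.

Lemma leq_tau_pos k : k <= tau_pos k.
Proof. by rewrite -{1}(size_mkseq tribonacci k) leq_size_tau. Qed.

Lemma child_nth k r : r < size (desc (tribonacci k)) ->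
  child k (nth (0, (0, 0, 0)%Z) (desc (tribonacci k)) r) (tau_pos k + r).
Proof.
move=> lt_r.
have lt_r' : r < size (tau_letter (tribonacci k)) by rewrite size_desc.
have E : tau_letter (tribonacci k) =
    mkseq (fun i => tribonacci (tau_pos k + i)) (size (desc (tribonacci k))).
  have := tau_tribonacci k.+1; rewrite tau_mkseqS tau_tribonacci tau_posS.
  rewrite /mkseq iotaD map_cat => /eqP.
  rewrite eqseq_cat // eqxx => /eqP->.
  by rewrite -[in LHS](addn0 (tau_pos k)) add0n iotaDl -map_comp.
have P : word_vec (tau_pos k + r) =
    vadd (vtau (word_vec k)) (parikh (take r (tau_letter (tribonacci k)))).
  rewrite /word_vec -parikh_tau -parikh_cat tau_tribonacci E; congr parikh.
  rewrite /mkseq -map_take take_iota (minn_idPl (ltnW lt_r)) iotaD map_cat.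
  by rewrite add0n -[in LHS](addn0 (tau_pos k)) iotaDl -map_comp addn0.
split; first exact: mem_nth.
  have <- : nth letter0 (tau_letter (tribonacci k)) r =
      tribonacci (tau_pos k + r).
    by rewrite E nth_mkseq.
  by case: (tribonacci k) lt_r => [[|[|[|]]] ?] //; case: r {E P lt_r'} => [|[|]].
rewrite P; congr vadd.
by case: (tribonacci k) lt_r => [[|[|[|]]] ?] //; case: r {E P lt_r'} => [|[|]].
Qed.

Lemma desc_child k e : e \in desc (tribonacci k) ->
  exists2 n, k <= n & child k e n.
Proof.
move=> /(nthP (0, (0, 0, 0)%Z))[r lt_r <-].
exists (tau_pos k + r); last exact: child_nth.
exact: leq_trans (leq_tau_pos k) (leq_addr _ _).
Qed.

Lemma ltn_tau_pos k : k.+1 < tau_pos k.+1.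
Proof.
elim: k => // k IH; rewrite tau_posS -addn1; apply: leq_add IH _.
by case: (tribonacci k.+1) => [[|[|[|]]] ?].
Qed.

(** The blocks tile the positions. Only 0 is its own parent, so descent to parents is well
    founded. *)
Lemma has_parent n : exists k e, child k e n /\ (k < n \/ n = 0).
Proof.
have [k [r [lt_r ->]]] :
    exists k r, r < size (desc (tribonacci k)) /\ n = tau_pos k + r.
  elim: n => [|n [k [r [lt_r ->]]]]; first by exists 0, 0.
  have [lt_r1|ge_r1] := ltnP r.+1 (size (desc (tribonacci k))).
    by exists k, r.+1; rewrite addnS.
  exists k.+1, 0; split; first by case: (tribonacci k.+1) => [[|[|[|]]] ?].
  rewrite tau_posS addn0 -addnS; congr (_ + _).
  by apply/eqP; rewrite eqn_leq lt_r.
exists k, (nth (0, (0, 0, 0)%Z) (desc (tribonacci k)) r).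
split; first exact: child_nth.
case: k lt_r => [|k] lt_r; first by case: r lt_r => [|r] _; [right | left; lia].
by left; apply: leq_trans (leq_addr _ _); exact: ltn_tau_pos.
Qed.

Lemma child_len k e n : child k e n ->
  (Z.of_nat n = Z.of_nat (tau_pos k) + vlen e.2 /\
   0 <= vlen e.2 <= Z.of_nat (size (desc (tribonacci k))) - 1)%Z.
Proof.
case=> ek _ /(congr1 vlen); rewrite vlen_word_vec -tau_pos_vec => ->.
have -> : vlen (vadd (vtau (word_vec k)) e.2) =
          (vlen (vtau (word_vec k)) + vlen e.2)%Z.
  by case: e.2 (word_vec k) => [[? ?] ?] [[? ?] ?] /=; lia.
split=> //; case: (tribonacci k) ek => [[|[|[|]]] ?] //=;
  rewrite !inE; do ?[case/orP]; by move/eqP->.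
Qed.

(** * Triples of positions and their offspring *)

Lemma triple_at_child i i' f n m e j j' g :
    child i' f i -> child m e n -> child j' g j ->
  triple_at i n j = Triple f.1 e.1 g.1
   (vsub (vsub (vadd (vtau (defect (triple_at i' m j'))) g.2) f.2) e.2).
Proof.
move=> [_ li Pi] [_ ln Pn] [_ lj Pj].
rewrite /triple_at li ln lj Pi Pn Pj; congr Triple; rewrite /defect.
move: (word_vec i') (word_vec m) (word_vec j') f.2 e.2 g.2 => ? ? ? ? ? ?.
vec_lia.
Qed.

Lemma child_offspring i i' f n m e j j' g :
    child i' f i -> child m e n -> child j' g j ->
  triple_at i n j \in offspring_at e (triple_at i' m j').
Proof.
move=> ci cn cj; rewrite (triple_at_child ci cn cj).
by case: ci cj => [? _ _] [? _ _]; apply: allpairs_f.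
Qed.

Lemma offspring_child n m e i' j' y :
    child m e n -> y \in offspring_at e (triple_at i' m j') ->
  exists i j, y = triple_at i n j.
Proof.
move=> cn /allpairsP[[f g] [/= /desc_child[i _ ci] /desc_child[j _ cj] ->]].
by exists i, j; rewrite (triple_at_child ci cn cj).
Qed.

Lemma vlen_triple_at i n j :
  vlen (defect (triple_at i n j)) = (Z.of_nat j - Z.of_nat i - Z.of_nat n)%Z.
Proof.
rewrite -!vlen_word_vec /=.
by move: (word_vec i) (word_vec n) (word_vec j) => u v w; vec_lia.
Qed.

Lemma child0 : child 0 (0, (0, 0, 0)%Z) 0.
Proof. by split; vm_compute. Qed.

Lemma child1 : child 0 (1, (1, 0, 0)%Z) 1.
Proof. by split; vm_compute. Qed.

Lemma child_eq0 k e n : child k e n -> n = 0 -> k = 0.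
Proof.
by move=> /child_len[+ [? _]] n0; rewrite n0; have := leq_tau_pos k; lia.
Qed.

Lemma triple_at_base j : in_window (triple_at 0 0 j) -> triple_at 0 0 j \in base.
Proof.
rewrite /in_window vlen_triple_at => w; have : j < 4 by lia.
by case: j {w} => [|[|[|[|]]]] // _; vm_compute.
Qed.

(** * Closure of the window and correctness of the automaton *)

Section Window.

Variables W K : seq triple.
Hypothesis WK_ok : window_ok W K.

Lemma parent_in_window i i' f n m e j j' g :
    (forall j0, in_window (triple_at i' m j0) -> triple_at i' m j0 \in W) ->
    child i' f i -> child m e n -> child j' g j ->
  in_window (triple_at i n j) -> in_window (triple_at i' m j').
Proof.
move=> inW /child_len[Ei bi] /child_len[En bn] /child_len[Ej bj].
rewrite /in_window !vlen_triple_at => w.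
have tauE j0 : let: (u, v, z) := defect (triple_at i' m j0) in
    (u + v + z = Z.of_nat j0 - Z.of_nat i' - Z.of_nat m /\
     2 * (u + v + z) - z =
     Z.of_nat (tau_pos j0) - Z.of_nat (tau_pos i') - Z.of_nat (tau_pos m))%Z.
  rewrite -!tau_pos_vec -!vlen_word_vec /triple_at /defect.
  case: (word_vec i') => [[? ?] ?]; case: (word_vec m) => [[? ?] ?].
  by case: (word_vec j0) => [[? ?] ?]; rewrite /vsub /vtau /vlen; lia.
apply/negPn/negP => w'.
have [hi|lo] : (3 < Z.of_nat j' - Z.of_nat i' - Z.of_nat m \/
   Z.of_nat j' - Z.of_nat i' - Z.of_nat m < -1)%Z by lia.
  (* Compare with the end position of defect sum exactly 3: its block ends no later than that of
     [j'] starts, so [window_top] puts [j] beyond the window. *)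
  have lt_j : i' + m + 3 < j' by lia.
  have := inW (i' + m + 3); rewrite /in_window vlen_triple_at => /(_ ltac:(lia)).
  move: (tau_pos_lt lt_j) (tauE (i' + m + 3)); rewrite /triple_at /defect.
  case: (vsub _ _) => [[u v] z] jj' [E1 E2] /(window_top WK_ok).
  by move/(_ ltac:(lia)); lia.
have lt_j : j' < i' + m - 1 by lia.
have := inW (i' + m - 1); rewrite /in_window vlen_triple_at => /(_ ltac:(lia)).
move: (tau_pos_lt lt_j) (tauE (i' + m - 1)); rewrite /triple_at /defect.
case: (vsub _ _) => [[u v] z] jj' [E1 E2] /(window_bottom WK_ok).
by move/(_ ltac:(lia)); lia.
Qed.

Lemma mem_window i n j : in_window (triple_at i n j) -> triple_at i n j \in W.
Proof.
(* The induction leaves [j] free, since [parent_in_window] needs the hypothesis at other end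
   positions. *)
have [N] := ubnP (i + n); elim: N i n j => // N IH i n j lt_N w.
have [i' [f [ci i'i]]] := has_parent i; have [m [e [cn mn]]] := has_parent n.
have [j' [g [cj _]]] := has_parent j.
have [/eqP|nz] := eqVneq (i + n) 0.
  rewrite addn_eq0 => /andP[/eqP i0 /eqP n0]; subst i n.
  exact: (base_window WK_ok (triple_at_base w)).
have lt_im : i' + m < i + n.
  have := child_eq0 ci; have := child_eq0 cn; lia.
apply: (window_closed WK_ok (x := triple_at i' m j')) => //.
  apply: (IH); first by lia.
  by apply: (parent_in_window _ ci cn cj w) => j0; apply: IH; lia.
apply/flatten_mapP; exists e; first by case: cn.
exact: (child_offspring ci cn cj).
Qed.

Definition realizes (n : nat) (s : state) : Prop :=
  s.1 = tribonacci n /\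
  (forall x, x \in s.2 <-> x \in K /\ exists i j, x = triple_at i n j).

(** Hence a tracked triple is always found among the offspring of tracked ones. *)
Lemma core_parent i i' f n m e j j' g :
    child i' f i -> child m e n -> child j' g j ->
  triple_at i n j \in K -> triple_at i' m j' \in K.
Proof.
move=> ci cn cj xK.
have w := parent_in_window (@mem_window _ _) ci cn cj (core_in_window WK_ok xK).
apply: (core_closed WK_ok (mem_window w) _ xK).
apply/flatten_mapP; exists e; first by case: cn.
exact: (child_offspring ci cn cj).
Qed.

Lemma realizes_child n n' e s :
  child n e n' -> realizes n s -> realizes n' (e.1, step K e s.2).
Proof.
move=> cn [sn sP]; split=> [|x] /=; first by case: cn.
rewrite mem_step; split=> [[xK _ [y /sP[_ [i [j ->]]] xy]]|[xK [i [j xE]]]].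
  by split=> //; apply: offspring_child xy.
have [i' [f [ci _]]] := has_parent i; have [j' [g [cj _]]] := has_parent j.
rewrite {}xE in xK *; split=> //; first by case: cn.
exists (triple_at i' n j'); last exact: child_offspring ci cn cj.
by apply/sP; split; [apply: (core_parent ci cn cj xK) | exists i', j'].
Qed.

Lemma realizes0 Z :
    (forall x, x \in Z -> x \in K /\ exists i j, x = triple_at i 0 j) ->
    {in base, forall x, x \in K -> x \in Z} ->
    {subset step K (0, (0, 0, 0)%Z) Z <= Z} ->
  realizes 0 (0, Z).
Proof.
move=> Zsound Zbase Zstep; split=> // x; split=> [/Zsound //|[xK [i [j xE]]]].
move: xK; rewrite {}xE {x}.
(* With [n = 0] kept as its own parent, [i] alone decreases until it is 0. *)
have [N] := ubnP i; elim: N i j => // N IH i j lt_iN xK.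
have [i' [f [ci i'i]]] := has_parent i; have [j' [g [cj _]]] := has_parent j.
case: i'i => [i'i|i0].
  apply: Zstep; apply/mem_step; split=> //; exists (triple_at i' 0 j').
    by apply: IH; [lia | exact: core_parent ci child0 cj xK].
  exact: child_offspring ci child0 cj.
subst i; apply: Zbase => //; apply: triple_at_base.
exact: (core_in_window WK_ok xK).
Qed.

Lemma realizes_states (L : seq state) s1 : realizes 1 s1 -> s1 \in L ->
    (forall s s', s \in L -> s' \in next_states K s -> s' \in L) ->
  forall n, 0 < n -> exists2 s, s \in L & realizes n s.
Proof.
move=> r1 s1L Lnext n; have [N] := ubnP n; elim: N n => // N IH n lt_nN n_gt0.
have [k [e [ck kn]]] := has_parent n.
(* The block of position 0 is [01], so 1 is the only positive position with parent 0. *)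
have [k0|k_gt0] := posnP k.
  subst k; have [+ _ _] := ck; have [+ _] := child_len ck.
  have -> : tau_pos 0 = 0 by [].
  rewrite !inE => nE /orP[]/eqP eE; move: nE; rewrite eE /= => nE; first by lia.
  by exists s1; last (have -> : n = 1 by lia).
have [s sL rs] : exists2 s, s \in L & realizes k s by apply: IH; lia.
exists (e.1, step K e s.2); last exact: realizes_child rs.
by apply: (Lnext s _ sL); apply: map_f; case: ck; case: rs => ->.
Qed.

Lemma realizes_next n s s' :
  realizes n s -> s' \in next_states K s -> exists2 n', n <= n' & realizes n' s'.
Proof.
move=> rs /mapP[e + ->]; rewrite (proj1 rs) => /desc_child[n' le_n cn].
by exists n' => //; apply: realizes_child rs.
Qed.

End Window.

(** * Abelian complexity as a count of defects *)

(** The count depends only on which elements share a value; this lets Parikh vectors replace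
    equivalence classes. *)
Lemma eq_size_undup_map (T U V : eqType) (F : T -> U) (G : T -> V) s :
    {in s &, forall x y, F x = F y <-> G x = G y} ->
  size (undup (map F s)) = size (undup (map G s)).
Proof.
elim: s => //= x s IH FG.
have -> : (F x \in map F s) = (G x \in map G s).
  by apply/mapP/mapP => -[y ys xy]; exists y => //; apply/FG;
    rewrite // ?mem_head // in_cons ys orbT.
have {}IH : size (undup (map F s)) = size (undup (map G s)).
  by apply: IH => y z ys zs; apply: FG; rewrite in_cons ?ys ?zs orbT.
by case: ifP; rewrite /= IH.
Qed.

Lemma parikh_abelian_equiv u v : abelian_equiv u v <-> parikh u = parikh v.
Proof.
split=> [/forallP uv|[/Nat2Z.inj u0 /Nat2Z.inj u1 /Nat2Z.inj u2]].
  by rewrite /parikh !(eqP (uv _)).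
apply/forallP => a; have : a \in [:: letter0; letter1; letter2].
  by case: a => [[|[|[|]]] ?].
by rewrite !inE => /or3P[] /eqP->; apply/eqP.
Qed.

Lemma word_vec_factor i n :
  vsub (word_vec (i + n)) (word_vec i) =
  parikh (mkseq (fun k => tribonacci (i + k)) n).
Proof.
rewrite /word_vec /mkseq iotaD map_cat parikh_cat add0n.
rewrite -[in iota i n](addn0 i) iotaDl -map_comp.
by move: (parikh _) (parikh _) => u v; vec_lia.
Qed.

Lemma abelian_complexity_parikh n :
  abelian_complexity tribonacci n =
  size (undup [seq vsub (parikh u) (word_vec n)
              | u : n.-tuple 'I_3 <- enum (factors tribonacci n)]).
Proof.
pose D := factors tribonacci n.
pose cls (u : n.-tuple 'I_3) := [set v in D | abelian_equiv u v].
have clsP u v : u \in enum D -> v \in enum D ->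
    cls u = cls v <-> parikh u = parikh v.
  rewrite !mem_enum => uD vD; rewrite -parikh_abelian_equiv; split=> [uv|uv].
    have : v \in cls u by rewrite uv inE vD; apply/forallP.
    by rewrite inE => /andP[].
  apply/setP => w; rewrite !inE; congr (_ && _).
  by case: (abelian_equiv_equivalence u v w) => _ ->.
transitivity (size (undup (map cls (enum D)))); last first.
  apply: eq_size_undup_map => u v uD vD; rewrite clsP //; split=> [->//|].
  move: (parikh u) (parikh v) (word_vec n).
  by move=> [[? ?] ?] [[? ?] ?] [[? ?] ?] [? ? ?]; congr (_, _, _); lia.
rewrite /abelian_complexity cardE; apply/perm_size/uniq_perm;
  rewrite ?enum_uniq ?undup_uniq //.
by move=> A; rewrite mem_enum mem_undup; apply/imsetP/mapP => -[u];
  rewrite ?mem_enum => uD ->; exists u; rewrite ?mem_enum.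
Qed.

Lemma rho_realizes W K n s :
  window_ok W K -> realizes K n s -> abelian_complexity tribonacci n = rho s.
Proof.
move=> WK_ok [sn sP]; rewrite abelian_complexity_parikh /rho.
apply/perm_size/uniq_perm; rewrite ?undup_uniq // => v; rewrite !mem_undup.
apply/mapP/mapP => [[u]|[x]].
  rewrite mem_enum inE => /asboolP[i]; rewrite size_tuple => uE ->.
  have E : vsub (parikh u) (word_vec n) = defect (triple_at i n (i + n)).
    by rewrite uE -word_vec_factor.
  exists (triple_at i n (i + n)) => //.
  have v0 : vlen (defect (triple_at i n (i + n))) = 0%Z.
    by rewrite vlen_triple_at; lia.
  rewrite mem_filter v0 /=; apply/sP; split; last by exists i, (i + n).
  apply: (window_core WK_ok _ v0); apply: (mem_window WK_ok).
  by rewrite /in_window v0.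
rewrite mem_filter => /andP[/Z.eqb_eq + /sP[_ [i [j xE]]]] ->.
rewrite xE vlen_triple_at => ij; have {ij}-> : j = i + n by lia.
pose u := [tuple tribonacci (i + k) | k < n].
have uE : u = mkseq (fun k => tribonacci (i + k)) n :> seq 'I_3.
  by rewrite /mkseq -val_enum_ord -map_comp /=; congr map; exact: val_ord_tuple.
exists u; last by rewrite uE -word_vec_factor.
by rewrite mem_enum inE; apply/asboolP; exists i; rewrite size_tuple.
Qed.

(** * From the finite checks to the theorem *)

Lemma complexity_of_automaton W K k fuel :
    window_ok W K -> automaton_ok K k fuel ->
  (forall n : nat, 0 < n ->
     abelian_complexity tribonacci n \in [:: 3; 4; 5; 6; 7]) /\
  (forall m : nat, m \in [:: 3; 4; 5; 6; 7] ->
     exists n : nat, 1 <= n /\ abelian_complexity tribonacci n = m).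
Proof.
move=> WK_ok; rewrite /automaton_ok.
set Z := zero_set K k; set s1 := state1 K k; set L := states K k fuel.
move=> /and5P[/allP Zbase /allP Zstep s1L /allP Lnext].
move=> /andP[/allP rhoL /allP rho_onto].
have r0 : realizes K 0 (0, Z).
  apply: (realizes0 WK_ok) => //.
    apply: zero_set_ind => [x xb|x y [i [j ->]]].
      have [j ->] : exists j, x = triple_at 0 0 j.
        by move: xb; rewrite !inE => /or4P[]/eqP->;
          [exists 0 | exists 1 | exists 2 | exists 3]; vm_compute.
      by exists 0, j.
    exact: offspring_child child0.
  by move=> x xb; apply/implyP/Zbase.
have r1 : realizes K 1 s1 := realizes_child WK_ok child1 r0.
split=> [n n_gt0|m /rho_onto/hasP[s sL /eqP <-]].
  have Lclosed s s' : s \in L -> s' \in next_states K s -> s' \in L.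
    by move=> /Lnext/allP; apply.
  have [s sL rs] := realizes_states WK_ok r1 s1L Lclosed n_gt0.
  by rewrite (rho_realizes WK_ok rs) rhoL.
(* [L] is explored from the state of length 1, so each of its states is realised by a positive
   length. *)
have [n n_gt0 rs] : exists2 n, 0 < n & realizes K n s.
  have one x : x \in [:: s1] -> exists2 n, 0 < n & realizes K n x.
    by rewrite inE => /eqP->; exists 1.
  apply: (explore_ind _ one one sL) => x y [n n_gt0 rx].
  move=> /(realizes_next WK_ok rx)[n' le_nn' ry].
  by exists n' => //; apply: leq_trans le_nn'.
by exists n; split=> //; apply: rho_realizes WK_ok rs.
Qed.

Definition window : seq triple :=
  explore (fun x => [seq y <- offspring x | in_window y]) 25 base base.

(* The window triples that have a descendant with defect sum 0; four generations
   are enough.  Tracking only these keeps the automaton small. *)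
Definition core : seq triple :=
  iter 4 (fun K : seq triple =>
      [seq x <- window | (x \in K) || has (mem K) (offspring x)])
    [seq x <- window | Z.eqb (vlen (defect x)) 0].

Lemma window_core_ok : window_ok window core.
Proof. by vm_compute. Qed.

(** The constants are numbers of rounds for [zero_set] and [states]; the closure clauses of the
    check confirm that they suffice. *)
Lemma automaton_core_ok : automaton_ok core 5 22.
Proof. by vm_compute. Qed.

Theorem theorem3 :
  (forall n : nat, 0 < n ->
     abelian_complexity tribonacci n \in [:: 3; 4; 5; 6; 7]) /\
  (forall m : nat, m \in [:: 3; 4; 5; 6; 7] ->
     exists n : nat, 1 <= n /\ abelian_complexity tribonacci n = m).
Proof. exact (complexity_of_automaton window_core_ok automaton_core_ok). Qed.
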